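(* Let $X$ be a geodesic metric space in which Morse geodesics are strongly contracting quantitatively, i.e. for every Morse gauge $M$ there is $D\ge 0$ such that every $M$-Morse geodesic in $X$ is $D$-strongly contracting. Then $X$ has the Morse local-to-global property. In particular, every injective metric space has the Morse local-to-global property.
   Context: A metric space $X$ is injective if for any families $\{x_i\}$ in $X$ and $\{r_i\}$ in $[0,\infty)$ with $d(x_i,x_j)\le r_i+r_j$ for all $i\ne j$, the closed balls satisfy $\bigcap_i B(x_i,r_i)\neq\emptyset$. For $k\ge 1,c\ge 0$, a $(k,c)$-quasi-geodesic in $X$ is a map $\beta:I\to X$ from an interval $I\subseteq\mathbb{R}$ with $\frac1k|s-t|-c\le d(\beta(s),\beta(t))\le k|s-t|+c$ for all $s,t\in I$. Given a Morse gauge $M:[1,\infty)\times[0,\infty)\to[0,\infty)$, a subset $Y\subseteq X$ is $M$-Morse if every $(\lambda,\epsilon)$-quasi-geodesic with endpoints on $Y$ is contained in the $M(\lambda,\epsilon)$-neighborhood of $Y$. A (quasi-)geodesic is $M$-Morse if its image is. For $Y\subseteq X$ and $x\in X$, let $\pi_Y(x)=\{y\in Y: d(x,y)\le d(x,Y)+1\}$ and $\pi_Y(B)=\bigcup_{x\in B}\pi_Y(x)$ for $B\subseteq X$. $Y$ is $D$-strongly contracting if $\mathrm{diam}(\pi_Y(B))\le D$ for every closed ball $B$ of $X$ disjoint from $Y$; a geodesic is $D$-strongly contracting if its image is. An $(M;k,c)$-Morse quasi-geodesic is an $M$-Morse $(k,c)$-quasi-geodesic. A map $\gamma:I\to X$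 from an interval is a $(B;M;k,c)$-local Morse quasi-geodesic if for any $[s,t]\subseteq I$ with $|s-t|\le B$ the restriction $\gamma|_{[s,t]}$ is an $(M;k,c)$-Morse quasi-geodesic. $X$ has the Morse local-to-global property if for every Morse gauge $M$ and constants $k\ge 1,c\ge 0$ there exist $B\ge 0$, a Morse gauge $M'$, and constants $k'\ge 1,c'\ge 0$ such that every $(B;M;k,c)$-local Morse quasi-geodesic in $X$ is an $(M';k',c')$-Morse quasi-geodesic. *)

(* Defs.v *)
From HB Require Import structures.
From mathcomp Require Import all_boot all_order all_algebra.
From mathcomp Require Import all_classical all_reals all_analysis.

Set Implicit Arguments.
Unset Strict Implicit.
Unset Printing Implicit Defensive.

Import Order.TTheory GRing.Theory Num.Theory.

Local Open Scope classical_set_scope.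
Local Open Scope ring_scope.

(* A map defined on an interval I is given by a total function R -> X together
   with the set I; its values outside I are never used. *)

Section MorseLocalToGlobal.
Context {R : realType} {X : metricType R}.
Implicit Types (I : set R) (g : R -> X) (Y A : set X) (x y : X).
Implicit Types (M : R -> R -> R) (k c D r : R).

(* The library's [closed_ball] is the closure of the open ball, which in a
   general metric space is smaller (and is empty for radius 0). *)
Definition cball x r : set X := [set y | mdist x y <= r].

Definition nbhd Y r : set X := [set x | exists2 y, Y y & mdist x y <= r].

(* Only meaningful for Y nonempty, as [inf set0 = 0]. *)
Definition dist_to x Y : R := inf [set mdist x y | y in Y].

(* [diam set0 = -oo]. *)
Definition diam A : \bar R :=
  ereal_sup [set (mdist p.1 p.2)%:E | p in A `*` A].

Definition coarse_proj Y x : set X :=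
  [set y | Y y /\ mdist x y <= dist_to x Y + 1].

Definition strongly_contracting D Y : Prop :=
  forall x r, 0 <= r -> cball x r `&` Y = set0 ->
    (diam (\bigcup_(z in cball x r) coarse_proj Y z) <= D%:E)%E.

Definition geodesic I g : Prop :=
  is_interval I /\ forall s t, I s -> I t -> mdist (g s) (g t) = `|s - t|.

Definition quasi_geodesic k c I g : Prop :=
  is_interval I /\
  forall s t, I s -> I t ->
    k^-1 * `|s - t| - c <= mdist (g s) (g t) /\
    mdist (g s) (g t) <= k * `|s - t| + c.

(* Outside [1, +oo[ x [0, +oo[ the values of a gauge are never used. *)
Definition morse_gauge M : Prop :=
  forall l e, 1 <= l -> 0 <= e -> 0 <= M l e.

Definition morse M Y : Prop :=
  forall l e, 1 <= l -> 0 <= e ->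
  forall (a b : R) (g : R -> X), a <= b ->
    quasi_geodesic l e `[a, b] g -> Y (g a) -> Y (g b) ->
    g @` `[a, b] `<=` nbhd Y (M l e).

Definition morse_quasi_geodesic M k c I g : Prop :=
  quasi_geodesic k c I g /\ morse M (g @` I).

Definition local_morse_quasi_geodesic (B : R) M k c I g : Prop :=
  is_interval I /\
  forall s t, s <= t -> `[s, t] `<=` I -> `|s - t| <= B ->
    morse_quasi_geodesic M k c `[s, t] g.

End MorseLocalToGlobal.

Section Spaces.
Context {R : realType}.

Definition geodesic_space (X : metricType R) : Prop :=
  forall x y : X, exists (a b : R) (g : R -> X),
    [/\ a <= b, geodesic `[a, b] g, g a = x & g b = y].

Definition injective_space (X : metricType R) : Prop :=
  forall (J : Type) (x : J -> X) (r : J -> R),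
    (forall i, 0 <= r i) ->
    (forall i j, i <> j -> mdist (x i) (x j) <= r i + r j) ->
    \bigcap_(i in [set: J]) cball (x i) (r i) !=set0.

Definition morse_geodesics_strongly_contracting (X : metricType R) : Prop :=
  forall M, morse_gauge M -> exists2 D : R, 0 <= D &
    forall (I : set R) (g : R -> X),
      geodesic I g -> morse M (g @` I) -> strongly_contracting D (g @` I).

Definition morse_local_to_global (X : metricType R) : Prop :=
  forall (M : R -> R -> R) (k c : R), morse_gauge M -> 1 <= k -> 0 <= c ->
  exists (B : R) (M' : R -> R -> R) (k' c' : R),
    [/\ 0 <= B, morse_gauge M', 1 <= k' & 0 <= c'] /\
    forall (I : set R) (g : R -> X),
      local_morse_quasi_geodesic B M k c I g ->
      morse_quasi_geodesic M' k' c' I g.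

End Spaces.

(* Main.v *)
Require Import Defs.
From mathcomp Require Import all_boot all_order all_algebra.
From mathcomp Require Import all_classical all_reals all_analysis.
From mathcomp Require Import lra.

(** Both halves rest on one observation about nearest-point projections: when
    a set [Y] is contracting, it is gated, that is, every geodesic from [x] to
    a point [q] of [Y] coarsely passes through the projection [p] of [x], so that
    [mdist x q] is [mdist x p + mdist p q] up to a constant
    ([contracting_gated]).

    Local to global. Let [g] be a local Morse quasi-geodesic. A short segment of [g]
    is close to a geodesic, which is Morse with a gauge independent of the
    segment and of the scale, hence uniformly contracting and gated; so is
    the segment ([morse_segment_tame]). Choose the scale large compared to these
    constants. For a fixed point [z] the function sending [t] to
    [mdist z (g t)] then has no local maximum, even coarsely: on each
    window it grows in both directions away from the gate of [z]
    ([no_local_max]). Once this function increases it therefore keeps increasing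
    at a linear rate ([distance_growth]). With [z] on [g] this is the lower
    bound of a quasi-geodesic; for general [z] it says that all
    nearest points of [z] on [g] are close together. So the projection to the
    image of [g] cannot jump, and local contraction gives global
    contraction ([global_contracting]). Contracting sets are Morse
    ([contracting_morse]): outside a neighbourhood of the set the projection moves
    more slowly than any quasi-geodesic must advance.

    Injective spaces. Common points of pairwise intersecting balls provide
    1-Lipschitz paths through prescribed points, in particular geodesics. If a Morse
    set were not gated, some geodesic with endpoints on it would leave
    a large neighbourhood ([morse_gated]). If it were gated but not contracting,
    there would be two points of equal, large height over it whose distance
    is at most that of their projections; going up, across and down again
    is a quasi-geodesic because distances dominate the l1 distance in
    height and projection, and it leaves a large neighbourhood too
    ([morse_gated_projection]). So Morse geodesics are strongly contracting and the
    first half applies. *)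

Set Implicit Arguments.
Unset Strict Implicit.
Unset Printing Implicit Defensive.

Import Order.TTheory GRing.Theory Num.Theory.

Local Open Scope classical_set_scope.
Local Open Scope ring_scope.

(** * Coarse projections and contracting sets *)

Section Metric.
Context {R : realType} {X : metricType R}.
Implicit Types x y z : X.

Lemma mdist_sym x y : mdist x y = mdist y x.
Proof. exact: metric_sym. Qed.

Lemma mdist_triangle x y z : mdist x z <= mdist x y + mdist y z.
Proof. exact: metric_triangle. Qed.

End Metric.

(** Distances enter linear arithmetic as atoms, and [mdist a b] and
    [mdist b a] are different atoms: hence the symmetry equations. *)
Ltac triangle a b c :=
  pose proof (mdist_triangle a b c); pose proof (mdist_sym a b);
  pose proof (mdist_sym b c); pose proof (mdist_sym a c).

Section Contracting.
Context {R : realType} {X : metricType R}.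
Implicit Types (Y S : set X) (x y z p q : X) (C D E e h : R).

(** Slack 1 is the slack of [coarse_proj]. Larger slacks appear when a
    nearest point of one point is used for a neighbouring point. *)
Definition nearest e Y x p : Prop :=
  Y p /\ forall q, Y q -> mdist x p <= mdist x q + e.

Lemma nearest_ex Y x : Y !=set0 -> exists p, nearest 1 Y x p.
Proof.
move=> [y0 Yy0].
have lbY : has_lbound [set mdist x y | y in Y].
  by exists 0 => _ [y _ <-]; exact: mdist_ge0.
have hi : has_inf [set mdist x y | y in Y].
  by split=> //; exists (mdist x y0), y0.
have [_ [p Yp <-] pinf] := inf_adherent ltr01 hi.
exists p; split=> // q Yq.
have : inf [set mdist x y | y in Y] <= mdist x q by apply: (ge_inf lbY); exists q.
lra.
Qed.

Lemma nearest_self Y x : Y x -> nearest 1 Y x x.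
Proof.
move=> Yx; split=> // q _; rewrite mdistxx.
have := mdist_ge0 x q; lra.
Qed.

Lemma nearest_subset e Y S x p : S `<=` Y -> S p -> nearest e Y x p -> nearest e S x p.
Proof. by move=> SY Sp [_ xp]; split=> // q /SY; exact: xp. Qed.

(** Strong contraction without infima, diameters and balls: the bound concerns
    the centre of a ball and one other point of it. The margin [E] keeps the
    ball off [Y]; leaving it free makes the notion stable under passing to
    a set at finite Hausdorff distance. *)
Definition contracting D E Y : Prop :=
  forall x y p q, nearest 1 Y x p -> nearest 1 Y y q ->
    mdist x y + E <= mdist x p -> mdist p q <= D.

Lemma strongly_contractingW D Y :
  strongly_contracting D Y -> contracting D 2 Y.
Proof.
move=> sY x y p q xp yq xy.
have xyY : cball x (mdist x y) `&` Y = set0.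
  apply/seteqP; split=> // z [].
  rewrite /cball/= => xz Yz; have := xp.2 _ Yz; lra.
have := sY x (mdist x y) (mdist_ge0 _ _) xyY.
have near_proj u r : nearest 1 Y u r -> coarse_proj Y u r.
  move=> [Yr ur]; split=> //; rewrite -lerBlDr; apply: lb_le_inf.
    by exists (mdist u r), r.
  by move=> _ [w Yw <-]; rewrite lerBlDr; exact: ur.
rewrite -lee_fin; apply: le_trans; apply: ereal_sup_ubound.
exists (p, q) => //; split=> /=.
  by exists x; [rewrite /cball/= mdistxx; exact: mdist_ge0 | exact: near_proj].
by exists y; [rewrite /cball/= lexx | exact: near_proj].
Qed.

(** Geodesics from [x] to points of [Y] coarsely pass through the projection
    of [x]. *)
Definition gated C Y : Prop :=
  forall x p q, nearest 1 Y x p -> Y q ->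
    mdist x p + mdist p q <= mdist x q + C.

(** By gatedness all almost nearest points of [x] cluster around one of them. *)
Lemma gated_nearest C e Y x p q : gated C Y -> nearest e Y x p -> Y q ->
  mdist x p + mdist p q <= mdist x q + 2 * C + 2 * e.
Proof.
move=> gY xp Yq.
have [|r xr] := @nearest_ex Y x; first by exists p; exact: xp.1.
have := gY _ _ _ xr Yq; have := gY _ _ _ xr xp.1; have := xp.2 _ xr.1.
triangle p r q; lra.
Qed.

Lemma contracting_weaken D D' E E' Y : D <= D' -> E <= E' ->
  contracting D E Y -> contracting D' E' Y.
Proof.
move=> DD EE cY x y p q xp yq xy; have := cY x y p q xp yq; lra.
Qed.

Lemma gated_weaken C C' Y : C <= C' -> gated C Y -> gated C' Y.
Proof.
move=> CC gY x p q xp Yq; have := gY x p q xp Yq; lra.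
Qed.

Section Transfer.
Context (C h : R) (S Y : set X).
Hypothesis SY : forall s, S s -> exists2 y, Y y & mdist s y <= h.
Hypothesis YS : forall y, Y y -> exists2 s, S s & mdist y s <= h.
Hypothesis gS : gated C S.

(** The point of [S] close to [p] is almost nearest in [S], and in a gated set
    almost nearest points are close together. *)
Lemma nearest_transfer x p s : nearest 1 Y x p -> nearest 1 S x s ->
  mdist s p <= C + 1 + 3 * h.
Proof.
move=> xp xs; have [p' Sp' pp'] := YS xp.1; have [s' Ys' ss'] := SY xs.1.
have := gS xs Sp'; have := xp.2 _ Ys'.
triangle x p p'; triangle x s s'; triangle s p' p; lra.
Qed.

Lemma gated_transfer : gated (3 * C + 2 + 8 * h) Y.
Proof.
move=> x p q xp Yq; have [q' Sq' qq'] := YS Yq.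
have [|s xs] := @nearest_ex S x; first by exists q'.
have := gS xs Sq'; have := nearest_transfer xp xs.
triangle x s p; triangle p s q; triangle s q' q; triangle x q q'; lra.
Qed.

Lemma contracting_transfer D E : contracting D E S ->
  contracting (D + 2 * (C + 1 + 3 * h)) (E + (C + 1 + 3 * h)) Y.
Proof.
move=> cS x y p q xp yq xy.
have [p' Sp' _] := YS xp.1.
have [|s xs] := @nearest_ex S x; first by exists p'.
have [|t yt] := @nearest_ex S y; first by exists p'.
have sp := nearest_transfer xp xs; have tq := nearest_transfer yq yt.
have /= : mdist x y + E <= mdist x s by triangle x s p; lra.
move=> /(cS _ _ _ _ xs yt).
triangle p s q; triangle s t q; lra.
Qed.

End Transfer.

(** Steps of length at most 1 along a geodesic stand in for continuity
    arguments: a first step with a given property always exists. *)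
Definition geodesic_walk n (u : nat -> X) x y : Prop :=
  [/\ u 0%N = x, u n = y, (forall i, mdist (u i) (u i.+1) <= 1) &
     forall i, mdist x (u i) + mdist (u i) y = mdist x y].

Lemma geodesic_walk_in (a b : R) (g : R -> X) : a <= b -> geodesic `[a, b] g ->
  exists n u, geodesic_walk n u (g a) (g b) /\ forall i, (g @` `[a, b]) (u i).
Proof.
move=> ab [_ gg].
pose v i : R := Num.min (a + i%:R) b.
have i0 (i : nat) : 0 <= i%:R :> R by exact: ler0n.
have vE i : v i = a + i%:R /\ a + i%:R <= b \/ v i = b /\ b <= a + i%:R.
  rewrite /v; case: leP => h; [by left | right; split=> //; exact: ltW].
have vab i : a <= v i /\ v i <= b.
  by case: (vE i) => [[-> ?]|[-> ?]]; have := i0 i; split; lra.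
have vI i : `[a, b]%classic (v i) by rewrite /= in_itv/=; apply/andP; exact: vab.
have aI : `[a, b]%classic a by rewrite /= in_itv/= lexx.
have bI : `[a, b]%classic b by rewrite /= in_itv/= lexx andbT.
exists (Num.truncn (b - a)).+1, (g \o v); split; last by move=> i; exists (v i).
split=> /=.
- rewrite /v addr0; congr g; case: leP => //; lra.
- congr g; case: (vE (Num.truncn (b - a)).+1) => [[-> h]|[-> h //]].
  have := truncnS_gt (b - a); lra.
- move=> i; rewrite gg//.
  have : i.+1%:R = i%:R + 1 :> R by rewrite natr1.
  have := vab i; have := vab i.+1.
  by rewrite ler_norml; case: (vE i) => [[-> ?]|[-> ?]];
    case: (vE i.+1) => [[-> ?]|[-> ?]]; lra.
- move=> i; rewrite !gg//; have [? ?] := vab i.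
  rewrite !ler0_norm; lra.
Qed.

Lemma geodesic_walk_ex x y : geodesic_space X ->
  exists n u, geodesic_walk n u x y.
Proof.
move=> gX; have [a [b [g [ab gg <- <-]]]] := gX x y.
by have [n [u [? _]]] := geodesic_walk_in ab gg; exists n, u.
Qed.

Lemma geodesic_point x y (t : R) : geodesic_space X -> 0 <= t <= mdist x y ->
  exists z, mdist x z = t /\ mdist z y = mdist x y - t.
Proof.
move=> gX /andP[t0 txy]; have [a [b [g [ab [_ gg] gx gy]]]] := gX x y.
have aI : `[a, b]%classic a by rewrite /= in_itv/= lexx.
have bI : `[a, b]%classic b by rewrite /= in_itv/= lexx andbT.
have xyE : mdist x y = b - a by rewrite -gx -gy gg// ler0_norm; lra.
have tI : `[a, b]%classic (a + t) by rewrite /= in_itv/=; apply/andP; split; lra.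
exists (g (a + t)); rewrite xyE -{1}gx -gy !gg// !ler0_norm; lra.
Qed.

(** On the way from [x] to [q] let [y] be the first step whose projection [r] is
    far from [p]. The step before it projects near [p], so [r] is still
    within a bounded distance of [p]. Conversely, if the balls around [x] and
    [y] that just miss [Y] had a common point, contraction applied to both
    would bring [r] too close to [p]; hence these balls are disjoint, and the
    geodesic spends at least [mdist x p + mdist y r] between [x] and [y]. What
    remains is at least the distance from [r] to [q]. *)
Lemma contracting_gated D E Y : geodesic_space X -> 0 <= D -> 0 <= E ->
  contracting D E Y -> gated (3 * D + 6 * E + 7) Y.
Proof.
move=> gX D0 E0 cY x p q xp Yq.
have Y0 : Y !=set0 by exists q.
have [n [u [u0 un u1 uxq]]] := geodesic_walk_ex x q gX.
pose far i := `[< exists2 r, nearest 1 Y (u i) r & 2 * D + 2 * E + 2 < mdist p r >].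
have nfar i r : ~~ far i -> nearest 1 Y (u i) r -> mdist p r <= 2 * D + 2 * E + 2.
  move=> /asboolPn nf ir; rewrite leNgt; apply/negP => pr.
  by apply: nf; exists r.
have far0 : ~~ far 0%N.
  apply/asboolPn => -[r]; rewrite u0 => xr.
  have := cY x x p r xp xr; rewrite mdistxx => c.
  have := xr.2 _ xp.1; triangle p x r.
  have [|] := lerP (0 + E) (mdist x p); [move=> /c; lra|lra].
have [farn|nfarn] := boolP (far n); last first.
  have := nfar n q nfarn; rewrite un => /(_ (nearest_self Yq)).
  have := xp.2 _ Yq; lra.
have exf : exists i, far i by exists n.
case: (ex_minnP exf) => -[|j] farj minj; first by rewrite farj in far0.
have nfarj : ~~ far j by apply/negP => /minj; rewrite ltnn.
have /asboolP[r yr pr] := farj.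
have [r' yr'] := nearest_ex (u j) Y0.
have pr' := nfar _ _ nfarj yr'.
have uj := u1 j; set y := u j.+1 in yr uj; set y' := u j in yr' uj.
(* the projection jumps by a bounded amount, also close to [Y] where
   contraction says nothing *)
have rr' : mdist r' r <= D + 2 * E + 5.
  have := cY _ _ _ _ yr' yr => c.
  have [|] := lerP (mdist y' y + E) (mdist y' r'); first by move=> /c; lra.
  have := yr.2 _ yr'.1; triangle r' y' r; triangle y' y r; triangle y y' r'; lra.
(* the two balls are disjoint *)
have xy : mdist x p + mdist y r - 2 * E <= mdist x y.
  rewrite leNgt; apply/negP => xy.
  have [xyp|pxy] := lerP (mdist x y + E) (mdist x p).
    have := cY _ _ _ _ xp yr xyp; lra.
  have [|ryx] := lerP (mdist y x + E) (mdist y r).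
    move=> /(cY _ _ _ _ yr xp); rewrite mdist_sym; lra.
  have := mdist_sym x y => sxy.
  have [|z [xz zy]] := @geodesic_point x y (mdist x p - E) gX; first by apply/andP; lra.
  have [s zs] := nearest_ex z Y0.
  have ps : mdist p s <= D by apply: (cY _ _ _ _ xp zs); lra.
  have rs : mdist r s <= D by apply: (cY _ _ _ _ yr zs); rewrite (mdist_sym y z); lra.
  triangle p s r; lra.
have := uxq j.+1; rewrite -/y.
triangle r y q; triangle p r q; triangle p r' r; lra.
Qed.

(** While a walk with short steps stays outside the [H]-neighbourhood of [Y],
    each step moves the projection by at most [D]; [n] is the first time that
    the walk comes back to this neighbourhood. *)
Lemma contracting_walk D E H Y (u : nat -> X) N p0 :
  0 <= D -> contracting D E Y -> (forall i, mdist (u i) (u i.+1) + E <= H) ->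
  Y (u N) -> nearest 1 Y (u 0%N) p0 -> 0 <= H ->
  exists n p, [/\ nearest 1 Y (u n) p, mdist (u n) p <= H + 1,
    mdist p0 p <= n%:R * D & forall i, (i < n)%N -> ~ Y (u i)].
Proof.
move=> D0 cY u1 YN u0p0 H0.
have Y0 : Y !=set0 by exists p0; exact: u0p0.1.
pose close i := `[< exists2 p, Y p & mdist (u i) p <= H >].
have exc : exists i, close i by exists N; apply/asboolP; exists (u N); rewrite ?mdistxx.
case: (ex_minnP exc) => n /asboolP[r Yr ur] minn.
have far i r' : (i < n)%N -> Y r' -> H < mdist (u i) r'.
  move=> i_n Yr'; rewrite ltNge; apply/negP => ir'.
  have : (n <= i)%N by apply: minn; apply/asboolP; exists r'.
  by rewrite leqNgt i_n.
have [p [up pn]] : exists p, nearest 1 Y (u n) p /\ mdist p0 p <= n%:R * D.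
  have : (n <= n)%N by [].
  elim: {-2}n => [_|i IH i_n]; first by exists p0; rewrite mul0r mdistxx.
  have [p [up pi]] := IH (ltnW i_n).
  have [q uq] := nearest_ex (u i.+1) Y0.
  exists q; split=> //.
  have : mdist p q <= D.
    by apply: (cY _ _ _ _ up uq); have := u1 i; have := far i _ i_n up.1; lra.
  by rewrite -natr1 mulrDl mul1r; triangle p0 p q; lra.
exists n, p; split=> //; first by have := up.2 _ Yr; lra.
move=> i i_n Yi; have := far i _ i_n Yi; rewrite mdistxx; lra.
Qed.

End Contracting.

(** * Contracting sets are Morse *)

Section Morse.
Context {R : realType} {X : metricType R}.
Implicit Types (Y S : set X) (x y z p q : X) (C D E e h : R).

(** Time steps of length [delta] make an [(l, e)]-quasi-geodesic advance by at
    least [delta / l = D + 1] per step on average, more than the [D] by which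
    the projection can move per step. [H] exceeds the length of one step by the
    contraction margin, so contraction applies outside the [H]-neighbourhood.
    The factor of [delta] bounds the number of steps of an excursion. *)
Definition contracting_gauge D E (l e : R) : R :=
  let delta := l * (D + 1) in let H := l * delta + e + E in
  l * ((2 * H + 2 * D + e + 4) * delta) + e + H + 1.

Lemma contracting_gauge_ge0 D E : 0 <= D -> 0 <= E ->
  morse_gauge (contracting_gauge D E).
Proof.
move=> D0 E0 l e l1 e0; rewrite /contracting_gauge.
have d0 : 0 <= l * (D + 1) by apply: mulr_ge0; lra.
have ld0 : 0 <= l * (l * (D + 1)) by apply: mulr_ge0; lra.
set d := l * (D + 1) in d0 ld0 *.
have : 0 <= l * ((2 * (l * d + e + E) + 2 * D + e + 4) * d).
  by apply: mulr_ge0; [lra|apply: mulr_ge0; lra].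
lra.
Qed.

(** One of the two directions in which an excursion is followed. The last time
    step is cut off at [T]; it cannot be preceded by another step at [T]
    because the walk stops on reaching [Y], whence the lower bound on [t]. *)
Lemma contracting_ray_walk D E Y (l e T : R) (b : R -> X) p0 :
  0 <= D -> 0 <= E -> 1 <= l -> 0 <= e -> 0 <= T -> contracting D E Y ->
  (forall s t, 0 <= s <= T -> 0 <= t <= T -> mdist (b s) (b t) <= l * `|s - t| + e) ->
  Y (b T) -> nearest 1 Y (b 0) p0 ->
  exists n t p, [/\ 0 <= t <= T, t <= n%:R * (l * (D + 1)),
    (n%:R - 1) * (l * (D + 1)) <= t & Y p] /\
    mdist (b t) p <= l * (l * (D + 1)) + e + E + 1 /\ mdist p0 p <= n%:R * D.
Proof.
move=> D0 E0 l1 e0 T0 cY bl YT bp0.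
set d := l * (D + 1).
have d1 : 1 <= d.
  by rewrite /d; apply: (le_trans l1); rewrite ler_peMr; lra.
pose v i : R := Num.min (i%:R * d) T.
have i0 (i : nat) : 0 <= i%:R * d by apply: mulr_ge0 => //; lra.
have vE i : v i = i%:R * d /\ i%:R * d <= T \/ v i = T /\ T <= i%:R * d.
  rewrite /v; case: leP => h; [by left | right; split=> //; exact: ltW].
have vT i : 0 <= v i <= T.
  by case: (vE i) => [[-> ?]|[-> ?]]; have := i0 i => ?; apply/andP; split; lra.
have step i : mdist (b (v i)) (b (v i.+1)) + E <= l * d + e + E.
  have iS : i.+1%:R * d = i%:R * d + d by rewrite -natr1 mulrDl mul1r.
  have vv : `|v i - v i.+1| <= d.
    by rewrite ler_norml; case: (vE i) => [[-> ?]|[-> ?]];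
      case: (vE i.+1) => [[-> ?]|[-> ?]]; lra.
  have := bl _ _ (vT i) (vT i.+1).
  have := ler_wpM2l (le_trans ler01 l1) vv; lra.
have vN : v (Num.truncn T).+1 = T.
  case: (vE (Num.truncn T).+1) => [[-> h]|[-> //]].
  have := truncnS_gt T; have : (Num.truncn T).+1%:R <= (Num.truncn T).+1%:R * d.
    by rewrite ler_peMr.
  lra.
have v0 : v 0%N = 0 by rewrite /v mul0r; case: leP => //; lra.
have H0 : 0 <= l * d + e + E.
  have : 0 <= l * d by apply: mulr_ge0; lra.
  lra.
have [|||n [p [up pn p0p far]]] := @contracting_walk _ _ D E (l * d + e + E) Y
    (b \o v) (Num.truncn T).+1 p0 D0 cY step.
- by rewrite /= vN.
- by rewrite /= v0.
- by [].
exists n, (v n), p; split=> //; split=> //.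
- by case: (vE n) => [[-> ?]|[-> ?]].
- case: n {up pn p0p} far => [_|n far]; first by rewrite v0; lra.
  have vn : v n = n%:R * d /\ n%:R * d <= T.
    case: (vE n) => [//|[vn _]].
    by have := far n (ltnSn n); rewrite /= vn.
  have nS : n.+1%:R = n%:R + 1 :> R by rewrite natr1.
  by rewrite nS addrK; case: (vE n.+1) => [[-> ?]|[-> ?]]; rewrite ?nS; lra.
- exact: up.1.
Qed.

(** From a point [g r] walk in both directions until the [H]-neighbourhood of [Y]
    is reached, after [n] and [m] steps. The ends are at distance at most
    [2H + 2 + (n + m)D] by projecting, and at least about [(n + m)(D + 1)]
    because [g] is a quasi-geodesic. So [n + m] is bounded, and [g r] is
    at bounded distance from the place where [Y] is approached. *)
Lemma contracting_morse D E Y : 0 <= D -> 0 <= E ->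
  contracting D E Y -> morse (contracting_gauge D E) Y.
Proof.
move=> D0 E0 cY l e l1 e0 a b g ab [_ gq] Ya Yb _ [r /= + <-].
rewrite in_itv/= => /andP[ar rb].
have [|p0 rp0] := @nearest_ex _ _ Y (g r); first by exists (g a).
have gI s : a <= s <= b -> (`[a, b]%classic : set R) s by rewrite /= in_itv.
have [|s t /andP[s0 sT] /andP[t0 tT]||| n [t [p [[tT tn nt Yp] [tp p0p]]]]] :=
  @contracting_ray_walk D E Y l e (b - r) (fun t => g (r + t)) p0 D0 E0 l1 e0 _ cY.
- lra.
- have [||_] := gq (r + s) (r + t); [apply: gI; lra|apply: gI; lra|].
  by congr (_ <= _ * `|_| + _); lra.
- by rewrite addrC subrK.
- by rewrite addr0.
have [|s t' /andP[s0 sT] /andP[t0 tT']||| m [s [q [[sT sm ms Yq] [sq p0q]]]]] :=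
  @contracting_ray_walk D E Y l e (r - a) (fun t => g (r - t)) p0 D0 E0 l1 e0 _ cY.
- lra.
- have [||_] := gq (r - s) (r - t'); [apply: gI; lra|apply: gI; lra|].
  by rewrite distrC; congr (_ <= _ * `|_| + _); lra.
- by rewrite opprB addrC subrK.
- by rewrite subr0.
exists p => //; rewrite /contracting_gauge.
set d := l * (D + 1) in tn nt tp sm ms sq *.
set H := l * d + e + E in tp sq *.
move: tT sT => /andP[t0 tb] /andP[s0 sa].
have d0 : 0 <= d by apply: mulr_ge0; lra.
have [||lo _] := gq (r - s) (r + t); [apply: gI; lra|apply: gI; lra|].
have [||_ up] := gq r (r + t); [apply: gI; lra|apply: gI; lra|].
have ts : `|r - s - (r + t)| = s + t by rewrite ler0_norm; lra.
have ts' : `|r - (r + t)| = t by rewrite ler0_norm; lra.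
rewrite ts in lo; rewrite ts' in up.
have nm : n%:R + m%:R <= 2 * H + 2 * D + e + 4.
  have : l^-1 * (s + t) >= (n%:R + m%:R - 2) * (D + 1).
    rewrite ler_pdivlMl; last lra.
    by rewrite mulrCA -/d; lra.
  triangle (g (r - s)) q (g (r + t)); triangle q p (g (r + t)); triangle q p0 p.
  lra.
have n0 : n%:R <= 2 * H + 2 * D + e + 4 by have := ler0n R m; lra.
have td : t <= (2 * H + 2 * D + e + 4) * d.
  by apply: (le_trans tn); apply: ler_wpM2r.
have := ler_wpM2l (le_trans ler01 l1) td.
triangle (g r) (g (r + t)) p; lra.
Qed.

End Morse.

(** * Morse quasi-geodesic segments *)

Section Segment.
Context {R : realType} {X : metricType R}.
Implicit Types (Y S : set X) (x y z p q : X) (C D E e h : R) (M : R -> R -> R).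

(** Quasi-geodesics need not be continuous, so one with endpoints in [S] becomes
    one with endpoints in [Y] by changing its values at the two endpoints only. *)
Lemma morse_nbhd M C h S Y :
  (forall s, S s -> exists2 y, Y y & mdist s y <= h) ->
  (forall y, Y y -> exists2 s, S s & mdist y s <= C) ->
  0 <= h -> 0 <= C -> morse_gauge M ->
  morse M Y -> morse (fun l e => M l (e + 2 * h) + h + C) S.
Proof.
move=> SY YS h0 C0 M0 mY l e l1 e0 a b g ab [Ig gq] Sa Sb x [t tab <-].
have M1 := M0 l (e + 2 * h) l1; have eh : 0 <= e + 2 * h by lra.
have {}M1 := M1 eh.
have [ya Yya aya] := SY _ Sa; have [yb Yyb byb] := SY _ Sb.
move: (tab); rewrite /= in_itv/= => /andP[a_t tb].
have [abE|nab] := eqVneq a b.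
  have -> : t = a by lra.
  by exists (g a) => //; rewrite mdistxx; lra.
pose g' s := if s == a then ya else if s == b then yb else g s.
have gg' s : mdist (g s) (g' s) <= h.
  rewrite /g'; case: eqP => [-> //|_]; case: eqP => [-> //|_].
  by rewrite mdistxx.
have g'q : quasi_geodesic l (e + 2 * h) `[a, b] g'.
  split=> // s u sI uI; have [lo up] := gq _ _ sI uI.
  have := gg' s; have := gg' u.
  triangle (g' s) (g s) (g' u); triangle (g s) (g u) (g' u).
  triangle (g s) (g' s) (g u); triangle (g' s) (g' u) (g u).
  by split; lra.
have g'a : Y (g' a) by rewrite /g' eqxx.
have g'b : Y (g' b) by rewrite /g' eqxx eq_sym (negPf nab).
have [|y Yy ty] := mY l (e + 2 * h) l1 eh a b g' ab g'q g'a g'b (g' t); first by exists t.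
have [s Ss ys] := YS _ Yy; exists s => //.
have := gg' t; triangle (g t) (g' t) s; triangle (g' t) y s; lra.
Qed.

(** Walk along the geodesic. Its points are close to values of [g], at parameters
    that jump by a bounded amount and that end at [w2]; the first such
    parameter beyond [w] is close to [w]. *)
Lemma quasi_geodesic_near_geodesic (k c h w1 w2 a b : R) (g s : R -> X) :
  1 <= k -> 0 <= c -> 0 <= h -> w1 <= w2 -> a <= b ->
  quasi_geodesic k c `[w1, w2] g -> geodesic `[a, b] s ->
  s a = g w1 -> s b = g w2 ->
  s @` `[a, b] `<=` nbhd (g @` `[w1, w2]) h ->
  forall w, w1 <= w <= w2 -> exists2 z, (s @` `[a, b]) z &
    mdist (g w) z <= h + k * (k * (1 + 2 * h + c)) + c.
Proof.
move=> k1 c0 h0 w12 ab [_ gq] gs sa sb sg w /andP[w1w ww2].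
have [n [u [[u0 un u1 _] us]]] := geodesic_walk_in ab gs.
have k0 : 0 <= k by lra.
have near i : exists v, [/\ w1 <= v <= w2, mdist (u i) (g v) <= h & i = n -> v = w2].
  have [->|in_] := eqVneq i n.
    by exists w2; rewrite un sb mdistxx lexx andbT.
  have [_ [v vw <-] uv] := sg _ (us i); exists v; split=> //.
  by move=> iE; rewrite iE eqxx in in_.
have {near} [v /all_and3[vw uv vn]] := choice near.
have exP : exists i, w <= v i by exists n; rewrite vn.
have gI r : w1 <= r <= w2 -> (`[w1, w2]%classic : set R) r by rewrite /= in_itv.
have wI : (`[w1, w2]%classic : set R) w by apply: gI; lra.
have K0 : 0 <= k * (k * (1 + 2 * h + c)).
  by apply: mulr_ge0; [lra|apply: mulr_ge0; lra].
case: (ex_minnP exP) => -[|i] wi mini.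
  (* the parameter of the first step need not be [w1], but it has to be near *)
  exists (u 0%N); first exact: us.
  have := uv 0%N; have /andP[? ?] := vw 0%N.
  have [||lo _] := gq w1 (v 0%N); [apply: gI; lra|exact: gI|].
  have [||_ up] := gq w w1; [exact: wI|apply: gI; lra|].
  rewrite u0 sa => uv0.
  have wv : `|w - w1| <= `|w1 - v 0%N| by rewrite ger0_norm ?ler0_norm; lra.
  have lo' : k^-1 * `|w1 - v 0%N| <= 1 + 2 * h + c by lra.
  rewrite ler_pdivrMl in lo'; last lra.
  have := ler_wpM2l k0 (le_trans wv lo'); lra.
have vi : v i < w.
  by rewrite ltNge; apply/negP => /mini; rewrite ltnn.
exists (u i.+1); first exact: us.
have := uv i; have := uv i.+1; have := u1 i => ui vi1 uvi.
have /andP[? ?] := vw i; have /andP[? ?] := vw i.+1.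
have [||lo _] := gq (v i) (v i.+1); [exact: gI|exact: gI|].
have [||_ up] := gq w (v i.+1); [exact: wI|exact: gI|].
have wv : `|w - v i.+1| <= `|v i - v i.+1| by rewrite !ler0_norm; lra.
have lo' : k^-1 * `|v i - v i.+1| <= 1 + 2 * h + c.
  triangle (g (v i)) (u i) (u i.+1); triangle (g (v i)) (u i.+1) (g (v i.+1)); lra.
rewrite ler_pdivrMl in lo'; last lra.
have := ler_wpM2l k0 (le_trans wv lo').
triangle (g w) (g (v i.+1)) (u i.+1); lra.
Qed.

End Segment.

Section Window.
Context {R : realType} {X : metricType R}.
Implicit Types (Y S : set X) (x y z p q : X) (C D E e h : R) (M : R -> R -> R).

Definition straight C (w1 w2 : R) (g : R -> X) : Prop :=
  forall w, w1 <= w <= w2 ->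
    mdist (g w1) (g w) + mdist (g w) (g w2) <= mdist (g w1) (g w2) + C.

(** What the local-to-global argument needs of a short segment, with one constant
    for everything. *)
Record tame k c C (w1 w2 : R) (g : R -> X) : Prop := Tame {
  tame_quasi : forall s t, w1 <= s <= w2 -> w1 <= t <= w2 ->
    k^-1 * `|s - t| - c <= mdist (g s) (g t) /\
    mdist (g s) (g t) <= k * `|s - t| + c;
  tame_gated : gated C (g @` `[w1, w2]);
  tame_contracting : contracting C C (g @` `[w1, w2]);
  tame_straight : straight C w1 w2 g }.

Lemma geodesic_quasi_geodesic (I : set R) (g : R -> X) :
  geodesic I g -> quasi_geodesic 1 0 I g.
Proof.
move=> [iI gg]; split=> // s t sI tI.
by rewrite gg// invr1 !mul1r subr0 addr0.
Qed.

(** The segment is within a Hausdorff distance [h], depending on the gauge and on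
    [k] and [c] only, of a geodesic between its endpoints. So that geodesic is Morse
    for a gauge independent of the segment, hence uniformly strongly contracting
    and gated, and these properties transfer back. Being close to the
    geodesic also makes the segment straight. *)
Lemma morse_segment_tame M k c : geodesic_space X ->
  morse_geodesics_strongly_contracting X -> morse_gauge M -> 1 <= k -> 0 <= c ->
  exists2 C, 0 <= C & forall w1 w2 (g : R -> X), w1 <= w2 ->
    morse_quasi_geodesic M k c `[w1, w2] g -> tame k c C w1 w2 g.
Proof.
move=> gX sX M0 k1 c0.
have h00 : 0 <= M 1 0 by apply: M0.
pose h := M 1 0 + k * (k * (1 + 2 * M 1 0 + c)) + c.
have kk0 : 0 <= k * (k * (1 + 2 * M 1 0 + c)).
  by apply: mulr_ge0; [lra|apply: mulr_ge0; lra].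
have h0 : 0 <= h by rewrite /h; lra.
have [|D D0 cD] := sX (fun l e => M l (e + 2 * h) + h + h).
  by move=> l e l1 e0; have := M0 l (e + 2 * h) l1; lra.
pose G := 3 * D + 6 * 2 + 7.
exists (3 * G + 2 + 8 * h + (D + 2 + 2 * (G + 1 + 3 * h))); first by rewrite /G; lra.
move=> w1 w2 g w12 [gq mg].
have [a [b [s [ab gs sa sb]]]] := gX (g w1) (g w2).
have gI r : w1 <= r <= w2 -> (g @` `[w1, w2]) (g r).
  by move=> rw; exists r => //; rewrite /= in_itv.
have w1I : w1 <= w1 <= w2 by rewrite lexx.
have w2I : w1 <= w2 <= w2 by rewrite lexx w12.
have sg : s @` `[a, b] `<=` nbhd (g @` `[w1, w2]) (M 1 0).
  apply: mg ab (geodesic_quasi_geodesic gs) _ _ => //.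
    by rewrite sa; exact: gI.
  by rewrite sb; exact: gI.
have gs_near := quasi_geodesic_near_geodesic k1 c0 h00 w12 ab gq gs sa sb sg.
have SY z : (s @` `[a, b]) z -> exists2 y, (g @` `[w1, w2]) y & mdist z y <= h.
  by move=> /sg[y gy zy]; exists y => //; rewrite /h; lra.
have YS y : (g @` `[w1, w2]) y -> exists2 z, (s @` `[a, b]) z & mdist y z <= h.
  by move=> [w + <-]; rewrite /= in_itv/= => ww; exact: gs_near.
have cS : contracting D 2 (s @` `[a, b]).
  apply: strongly_contractingW; apply: cD => //.
  exact: (morse_nbhd SY YS h0 h0 M0 mg).
have gS : gated G (s @` `[a, b]) by apply: contracting_gated => //; lra.
have cY := contracting_transfer SY YS gS cS.
have gY := gated_transfer SY YS gS.
split.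
- by move=> u v uw vw; apply: gq.2; rewrite /= in_itv.
- by apply: gated_weaken gY; rewrite /G; lra.
- by apply: contracting_weaken cY; rewrite /G; lra.
- move=> w ww; have [_ [t tI <-] zw] := gs_near w ww; rewrite -/h in zw.
  move: (tI); rewrite /= in_itv/= => /andP[at_ tb].
  have aI : `[a, b]%classic a by rewrite /= in_itv/= lexx.
  have bI : `[a, b]%classic b by rewrite /= in_itv/= lexx andbT.
  have atE := gs.2 _ _ aI tI; have tbE := gs.2 _ _ tI bI; have abE := gs.2 _ _ aI bI.
  rewrite ler0_norm in atE; last lra.
  rewrite ler0_norm in tbE; last lra.
  rewrite ler0_norm in abE; last lra.
  rewrite sa in atE abE; rewrite sb in tbE abE.
  triangle (g w1) (s t) (g w); triangle (g w) (s t) (g w2).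
  rewrite /G; lra.
Qed.

End Window.

(** * From local to global *)

Section LocalToGlobal.
Context {R : realType} {X : metricType R}.
Variables (k c C : R) (I : set R) (g : R -> X).
Hypotheses (k1 : 1 <= k) (c0 : 0 <= c) (C0 : 0 <= C).
Hypothesis iI : is_interval I.

(* [k^-1 * delta] beats all errors: a segment of parameter length between [delta]
   and [4 * delta] has endpoints at distance at least [3 * C + 20]. The largest
   windows below consist of two steps of length at most [2 * delta]. *)
Let delta := k * (c + 3 * C + 20).
Hypothesis loc : forall w1 w2, w1 <= w2 -> I w1 -> I w2 -> w2 - w1 <= 4 * delta ->
  tame k c C w1 w2 g.

(* Linear arithmetic looks at the local hypotheses of a proof only, not at those of
   the section: the proofs below restate them. *)
Let constants : [/\ 1 <= k, 0 <= c, 0 <= C & 20 <= delta].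
Proof.
split=> //; move: k1 c0 C0 => k1' c0' C0'.
have S0 : 0 <= c + 3 * C + 20 by lra.
by have := ler_wpM2r S0 k1'; rewrite mul1r -/delta; lra.
Qed.

Let winI w1 w2 : I w1 -> I w2 -> forall w, w1 <= w <= w2 -> I w.
Proof. by move=> I1 I2 w ?; apply: iI I1 I2 _ _. Qed.

Let window_sub w1 w2 : I w1 -> I w2 -> g @` `[w1, w2] `<=` g @` I.
Proof.
move=> I1 I2 _ [w + <-]; rewrite /= in_itv/= => ww; exists w => //.
exact: winI I1 I2 _ ww.
Qed.

Let window_in w1 w2 w : w1 <= w <= w2 -> (g @` `[w1, w2]) (g w).
Proof. by move=> ww; exists w => //; rewrite /= in_itv. Qed.

Let window_long s t : I s -> I t -> delta <= t - s <= 4 * delta ->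
  3 * C + 20 <= mdist (g s) (g t).
Proof.
have [k1' c0' C0' delta20] := constants.
move=> Is It /andP[dst std].
have st : s <= t by lra.
have sI : s <= s <= t by rewrite lexx.
have tI : s <= t <= t by rewrite lexx st.
have [lo _] := tame_quasi (loc st Is It std) sI tI.
apply: le_trans lo; have -> : 3 * C + 20 = c + 3 * C + 20 - c by lra.
rewrite lerD2r ler_pdivlMl -/delta; last lra.
rewrite ler0_norm; lra.
Qed.

(** The window around [w] is gated: the distance to [z] grows along the window, in
    both directions, from the parameter [m] of a nearest point. One of the
    two ends of the window lies beyond [w] as seen from [m]. *)
Lemma no_local_max z w dl : delta <= dl <= 2 * delta -> I (w - dl) -> I (w + dl) ->
  mdist z (g w) + 4 <= mdist z (g (w + dl)) \/
  mdist z (g w) + 4 <= mdist z (g (w - dl)).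
Proof.
have [k1' c0' C0' delta20] := constants.
move=> /andP[dl1 dl2] I1 I2.
have w12 : w - dl <= w + dl by lra.
have Iw : I w by apply: (winI I1 I2); lra.
have w1in : w - dl <= w - dl <= w + dl by rewrite lexx.
have w2in : w - dl <= w + dl <= w + dl by rewrite lexx w12.
have w12d : w + dl - (w - dl) <= 4 * delta by lra.
have tm := loc w12 I1 I2 w12d.
have [|p zp] := @nearest_ex _ _ (g @` `[w - dl, w + dl]) z.
  by exists (g (w - dl)); exact: window_in.
have [m + pE] := zp.1; rewrite /= in_itv/= => /andP[m1 m2].
have Im : I m by apply: (winI I1 I2); lra.
have [mw|wm] := lerP m w; [left|right].
- have := tame_gated tm zp (window_in w2in); rewrite -pE.
  have mw2 : m <= w + dl by lra.
  have mw2d : w + dl - m <= 4 * delta by lra.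
  have win : m <= w <= w + dl by lra.
  have := tame_straight (loc mw2 Im I2 mw2d) win.
  have : 3 * C + 20 <= mdist (g w) (g (w + dl)) by apply: window_long => //; lra.
  triangle z (g m) (g w); lra.
- have := tame_gated tm zp (window_in w1in); rewrite -pE.
  have w1m : w - dl <= m by lra.
  have w1md : m - (w - dl) <= 4 * delta by lra.
  have win : w - dl <= w <= m by lra.
  have := tame_straight (loc w1m I1 Im w1md) win.
  have : 3 * C + 20 <= mdist (g (w - dl)) (g w) by apply: window_long => //; lra.
  triangle z (g m) (g w); triangle (g m) (g w) (g (w - dl)).
  triangle (g (w - dl)) (g m) (g w); lra.
Qed.

(** Step lengths range over [[delta, 2 delta]] so that steps of equal length fill
    an interval exactly. *)
Lemma subdivide u v : delta <= v - u -> exists n dl,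
  [/\ delta <= dl <= 2 * delta, v = u + n.+1%:R * dl & n.+1%:R * delta <= v - u].
Proof.
have [k1' c0' C0' delta20] := constants.
move=> uv.
have d0 : 0 < delta by lra.
have q1 : 1 <= (v - u) / delta by rewrite ler_pdivlMr// mul1r.
have q0 : 0 <= (v - u) / delta by lra.
have /andP[n1 n2] := truncn_itv q0.
set n := Num.truncn _ in n1 n2.
have n_gt0 : (0 < n)%N by rewrite /n truncn_gt0.
have nR : 1 <= n%:R :> R by rewrite (ler_nat _ 1).
rewrite ler_pdivlMr// in n1; rewrite ltr_pdivrMr// -natr1 in n2.
exists n.-1, ((v - u) / n%:R); rewrite prednK//; split=> //.
- apply/andP; split; first by rewrite ler_pdivlMr; lra.
  rewrite ler_pdivrMr; last lra.
  have := ler_wpM2r (ltW d0) nR; lra.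
- by rewrite mulrC mulfVK; [lra|rewrite gt_eqF//; lra].
Qed.

(** The distance to [z] increases on the first step, as [g s] is almost nearest
    to [z], and the absence of local maxima keeps it increasing. *)
Lemma distance_growth z s dl n : delta <= dl <= 2 * delta -> I s ->
  I (s + n.+1%:R * dl) -> nearest 3 (g @` I) z (g s) ->
  mdist z (g s) + n.+1%:R * 4 <= mdist z (g (s + n.+1%:R * dl)).
Proof.
have [k1' c0' C0' delta20] := constants.
move=> dld Is In zs; have /andP[dl1 dl2] := dld.
have Ii i : (i <= n.+1)%N -> I (s + i%:R * dl).
  move=> i_n; apply: (winI Is In).
  have : i%:R * dl <= n.+1%:R * dl by apply: ler_wpM2r; [lra|rewrite ler_nat].
  have : 0 <= i%:R * dl by apply: mulr_ge0; [exact: ler0n|lra].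
  by move=> ? ?; apply/andP; split; lra.
pose f i := mdist z (g (s + i%:R * dl)).
have f0 : f 0%N = mdist z (g s) by rewrite /f mul0r addr0.
have f1 : f 0%N + 4 <= f 1%N.
  rewrite f0 /f mul1r; have I1 := Ii 1%N isT; rewrite mul1r in I1.
  have ss : s <= s + dl by lra.
  have ssd : s + dl - s <= 4 * delta by lra.
  have sin : s <= s <= s + dl by rewrite lexx.
  have tin : s <= s + dl <= s + dl by rewrite lexx ss.
  have zs' := nearest_subset (window_sub Is I1) (window_in sin) zs.
  have := gated_nearest (tame_gated (loc ss Is I1 ssd)) zs' (window_in tin).
  have : 3 * C + 20 <= mdist (g s) (g (s + dl)) by apply: window_long => //; lra.
  lra.
suff : forall i, (i <= n)%N -> f i + 4 <= f i.+1.
  move=> fS; suff : forall i, (i <= n.+1)%N -> f 0%N + i%:R * 4 <= f i.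
    by move=> /(_ n.+1 (leqnn _)); rewrite f0.
  elim=> [_|i IH i_n]; first by rewrite mul0r addr0.
  by have := fS i i_n; have := IH (ltnW i_n); rewrite -natr1; lra.
elim=> [//|i IH i_n].
have := IH (ltnW i_n); rewrite /f.
have e1 : s + i%:R * dl = s + i.+1%:R * dl - dl by rewrite -natr1; lra.
have e2 : s + i.+2%:R * dl = s + i.+1%:R * dl + dl by rewrite -(natr1 i.+1); lra.
have := Ii i (leqW (ltnW i_n)); have := Ii i.+2 i_n; rewrite e1 e2 => I2 I1.
have := no_local_max z dld I1 I2; lra.
Qed.

(** Were [s] and [t] further apart, the distance to [z] would grow by at least 4
    from [s] to [t], more than the slack 3. *)
Lemma nearest_params z s t : I s -> I t -> s <= t ->
  nearest 3 (g @` I) z (g s) -> nearest 3 (g @` I) z (g t) -> t - s < delta.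
Proof.
have [k1' c0' C0' delta20] := constants.
move=> Is It st zs zt; rewrite ltNge; apply/negP => /subdivide[n [dl [dld tE _]]].
rewrite tE in It.
have := distance_growth dld Is It zs; rewrite -tE.
have := zt.2 _ zs.1; have := ler0n R n; rewrite -natr1; lra.
Qed.

(** For the lower bound, [g s] is nearest to [z := g s] itself, and the growth of
    the distance to [z] is linear. *)
Lemma global_quasi_geodesic : quasi_geodesic (k + c + delta) c I g.
Proof.
have [k1' c0' C0' delta20] := constants.
split=> //.
have k'0 : 0 < k + c + delta by lra.
suff main s t : I s -> I t -> s <= t -> (k + c + delta)^-1 * (t - s) - c <= mdist (g s) (g t) /\
    mdist (g s) (g t) <= (k + c + delta) * (t - s) + c.
  move=> s t Is It; have [st|ts] := lerP s t.
    exact: main.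
  by rewrite mdist_sym; apply: main => //; exact: ltW.
move=> Is It st.
have [dst|tsd] := lerP delta (t - s); last first.
  have std : t - s <= 4 * delta by lra.
  have sin : s <= s <= t by rewrite lexx.
  have tin : s <= t <= t by rewrite lexx st.
  have [lo up] := tame_quasi (loc st Is It std) sin tin.
  rewrite ler0_norm ?subr_le0// opprB in lo up; split.
    apply: le_trans lo; rewrite lerD2r ler_wpM2r; [by []|lra|].
    by rewrite lef_pV2 ?posrE; lra.
  have : 0 <= (c + delta) * (t - s) by apply: mulr_ge0; lra.
  lra.
have [n [dl [dld tE nd]]] := subdivide dst.
have /andP[dl1 dl2] := dld.
have It' := It; rewrite tE in It'.
split.
  have zs : nearest 3 (g @` I) (g s) (g s).
    have [Y0 H] := nearest_self (imageP g Is).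
    by split=> // q /H; lra.
  have := distance_growth dld Is It' zs; rewrite -tE mdistxx.
  suff : (k + c + delta)^-1 * (t - s) <= n.+1%:R * 4 by lra.
  rewrite ler_pdivrMl// tE [X in X <= _](_ : _ = n.+1%:R * dl); last lra.
  rewrite mulrCA ler_wpM2l//; lra.
have Ii i : (i <= n.+1)%N -> I (s + i%:R * dl).
  move=> i_n; apply: (winI Is It').
  have : i%:R * dl <= n.+1%:R * dl by apply: ler_wpM2r; [lra|rewrite ler_nat].
  have : 0 <= i%:R * dl by apply: mulr_ge0; [exact: ler0n|lra].
  by move=> ? ?; apply/andP; split; lra.
have : mdist (g s) (g (s + n.+1%:R * dl)) <= n.+1%:R * (k * dl + c).
  have : (n.+1 <= n.+1)%N by [].
  elim: {-2}n.+1 => [_|i IH i_n]; first by rewrite !mul0r addr0 mdistxx.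
  have I1 := Ii i (ltnW i_n); have I2 := Ii i.+1 i_n.
  have eS : s + i.+1%:R * dl = s + i%:R * dl + dl by rewrite -natr1; lra.
  have := IH (ltnW i_n); rewrite eS in I2 *.
  have ss : s + i%:R * dl <= s + i%:R * dl + dl by lra.
  have ssd : s + i%:R * dl + dl - (s + i%:R * dl) <= 4 * delta by lra.
  have sin : s + i%:R * dl <= s + i%:R * dl <= s + i%:R * dl + dl by rewrite lexx.
  have tin : s + i%:R * dl <= s + i%:R * dl + dl <= s + i%:R * dl + dl by rewrite lexx ss.
  have [_] := tame_quasi (loc ss I1 I2 ssd) sin tin.
  rewrite ler0_norm; last lra.
  triangle (g s) (g (s + i%:R * dl)) (g (s + i%:R * dl + dl)).
  rewrite -natr1; lra.
rewrite -tE => up.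
have nts : n.+1%:R <= t - s.
  apply: le_trans nd; rewrite ler_peMr//; lra.
have tsE : n.+1%:R * dl = t - s by lra.
have := ler_wpM2l c0' nts; have : 0 <= delta * (t - s) by apply: mulr_ge0; lra.
have : n.+1%:R * (k * dl + c) = k * (n.+1%:R * dl) + c * n.+1%:R by lra.
rewrite tsE; lra.
Qed.

(** Walk from [x] to [y]. Consecutive steps have nearest points at nearby parameters,
    so as long as the parameter is near [s0] both lie in a common window, where
    local contraction pushes the parameter back to within [delta] of
    [s0]. Hence the parameter never escapes from that window. *)
Lemma global_contracting : geodesic_space X -> contracting C C (g @` I).
Proof.
have [k1' c0' C0' delta20] := constants.
move=> gX x y p q xp yq xy; have [s0 Is0 pE] := xp.1; have [t It qE] := yq.1.
rewrite -{}pE in xp xy *; rewrite -{}qE in yq *.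
have [n [u [u0 un u1 uxy]]] := geodesic_walk_ex x y gX.
have Y0 : (g @` I) !=set0 by exists (g s0); exists s0.
have close i s : I s -> nearest 1 (g @` I) (u i) (g s) -> `|s0 - s| <= 2 * delta ->
    mdist (g s0) (g s) <= C.
  move=> Is us s0s.
  pose a := Num.min s0 s; pose b := Num.max s0 s.
  have /and5P[? ? ? ? ?] : [&& a <= s0, a <= s, s0 <= b, s <= b & b - a <= 2 * delta].
    rewrite /a /b; move: s0s; rewrite ler_norml.
    by case: (lerP s0 s) => ? /andP[? ?]; apply/and5P; split; lra.
  have Ia : I a by rewrite /a; case: (lerP s0 s).
  have Ib : I b by rewrite /b; case: (lerP s0 s).
  have ab : a <= b by lra.
  have abd : b - a <= 4 * delta by lra.
  have s0in : a <= s0 <= b by lra.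
  have sin : a <= s <= b by lra.
  apply: (tame_contracting (loc ab Ia Ib abd)).
  - exact: nearest_subset (window_sub Ia Ib) (window_in s0in) xp.
  - exact: nearest_subset (window_sub Ia Ib) (window_in sin) us.
  - have := uxy i; have := mdist_ge0 (u i) y; lra.
have short s : I s -> `|s0 - s| <= 2 * delta -> mdist (g s0) (g s) <= C -> `|s0 - s| <= delta.
  move=> Is; have [s0s|ss0] := lerP s0 s.
    move=> ? gC; rewrite leNgt; apply/negP => ?.
    have : 3 * C + 20 <= mdist (g s0) (g s) by apply: window_long => //; lra.
    lra.
  move=> ? gC; rewrite leNgt; apply/negP => ?.
  have : 3 * C + 20 <= mdist (g s) (g s0) by apply: window_long => //; lra.
  rewrite mdist_sym; lra.
have weak z v : nearest 1 (g @` I) z v -> nearest 3 (g @` I) z v.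
  by move=> [Yv zv]; split=> // r Yr; have := zv r Yr; lra.
have params z s s' : I s -> I s' -> nearest 3 (g @` I) z (g s) ->
    nearest 3 (g @` I) z (g s') -> `|s - s'| <= delta.
  move=> Is Is' zs zs'; have [ss'|s's] := lerP s s'.
    apply: ltW; exact: nearest_params zs zs'.
  apply: ltW.
  by apply: nearest_params zs' zs => //; exact: ltW.
suff key i s : I s -> nearest 1 (g @` I) (u i) (g s) -> `|s0 - s| <= 2 * delta.
  have ut : nearest 1 (g @` I) (u n) (g t) by rewrite un.
  exact: close It ut (key _ _ It ut).
elim: i s => [|i IH] s Is us.
  rewrite u0 in us; have := params _ _ _ Is0 Is (weak _ _ xp) (weak _ _ us); lra.
have [_ [[s' Is' <-] us']] := nearest_ex (u i) Y0.
have {us'} up : nearest 1 (g @` I) (u i) (g s') by split=> //; exists s'.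
have s's0 := short _ Is' (IH _ Is' up) (close _ _ Is' up (IH _ Is' up)).
have us' : nearest 3 (g @` I) (u i) (g s).
  split; first by exists s.
  move=> r Yr; have := us.2 _ Yr; have := u1 i.
  triangle (u i) (u i.+1) (g s); triangle (u i.+1) (u i) r; lra.
have := params _ _ _ Is' Is (weak _ _ up) us'.
have := ler_normD (s0 - s') (s' - s).
have -> : s0 - s' + (s' - s) = s0 - s by lra.
lra.
Qed.

End LocalToGlobal.

Lemma contracting_local_to_global (R : realType) (X : metricType R) :
  geodesic_space X -> morse_geodesics_strongly_contracting X ->
  morse_local_to_global X.
Proof.
move=> gX sX M k c M0 k1 c0.
have [C C0 CP] := morse_segment_tame gX sX M0 k1 c0.
pose delta := k * (c + 3 * C + 20).
have d0 : 0 <= delta by apply: mulr_ge0; lra.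
exists (4 * delta), (contracting_gauge C C), (k + c + delta), c.
split; first by split; [lra|exact: contracting_gauge_ge0|lra|].
move=> I g [iI lg].
have loc w1 w2 : w1 <= w2 -> I w1 -> I w2 -> w2 - w1 <= 4 * delta -> tame k c C w1 w2 g.
  move=> w12 I1 I2 w12d; apply: CP => //; apply: lg => //.
    by move=> w; rewrite /= in_itv/= => ww; apply: iI I1 I2 _ _.
  by rewrite ler0_norm ?subr_le0// opprB.
split; first exact: global_quasi_geodesic loc.
apply: contracting_morse => //.
exact: global_contracting loc gX.
Qed.

(** * Injective spaces *)

Section Injective.
Context {R : realType} {X : metricType R}.
Implicit Types (Y S : set X) (x y z p q : X) (C D E e h : R) (M : R -> R -> R).

Definition lipschitz_graph (G : set (R * X)) : Prop :=
  forall u v, G u -> G v -> mdist u.2 v.2 <= `|u.1 - v.1|.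

(** A maximal 1-Lipschitz graph is defined everywhere: the possible values at [s]
    form the intersection of the balls around its points [(t, x)], of radii
    [`|t - s|], and these balls satisfy the hypothesis of injectivity. *)
Lemma lipschitz_extension (F : set (R * X)) : injective_space X ->
  lipschitz_graph F -> exists g : R -> X,
    (forall u, F u -> g u.1 = u.2) /\ forall s t, mdist (g s) (g t) <= `|s - t|.
Proof.
move=> iX lipF.
have [K KP totK|G [lipG maxG]] := @Zorn_bigcup _ [set G | lipschitz_graph (F `|` G)].
  move=> u v [Fu|[G KG Gu]] [Fv|[H KH Hv]].
  - exact: lipF.
  - by apply: (KP _ KH); [left|right].
  - by apply: (KP _ KG); [right|left].
  - have [GH|HG] := totK _ _ KG KH.
      by apply: (KP _ KH); right => //; exact: GH.
    by apply: (KP _ KG); right => //; exact: HG.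
have ext s : exists x, (F `|` G) (s, x).
  have [i|i j _|x xP] := iX {u | (F `|` G) u} (fun i => (sval i).2)
      (fun i => `|(sval i).1 - s|).
  - exact: normr_ge0.
  - apply: le_trans (lipG _ _ (svalP i) (svalP j)) _.
    rewrite (distrC (sval j).1 s); exact: ler_distD.
  have xG u : (F `|` G) u -> mdist u.2 x <= `|u.1 - s|.
    by move=> Gu; have := xP (exist _ u Gu) I.
  exists x; apply: contrapT => nx.
  apply: (maxG (G `|` [set (s, x)])).
    split; first by left.
    by move=> sub; apply: nx; right; apply: sub; right.
  move=> u v; rewrite setUA => -[Gu|->] [Gv|->] /=.
  - exact: lipG.
  - exact: xG.
  - by rewrite mdist_sym distrC; exact: xG.
  - by rewrite mdistxx.
have [g gP] := choice ext.
exists g; split=> [[s x] Fs|s t]; last exact: (lipG _ _ (gP s) (gP t)).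
apply: mdist_positivity; apply/eqP; rewrite eq_le mdist_ge0 andbT.
have FGs : (F `|` G) (s, x) by left.
by have := lipG _ _ (gP s) FGs; rewrite /= subrr normr0.
Qed.

Lemma lipschitz_path4 x0 x1 x2 x3 (a b c : R) : injective_space X ->
  mdist x0 x1 <= a -> mdist x1 x2 <= b -> mdist x2 x3 <= c ->
  exists g : R -> X, [/\ g 0 = x0, g a = x1, g (a + b) = x2 & g (a + b + c) = x3] /\
    forall s t, mdist (g s) (g t) <= `|s - t|.
Proof.
move=> iX x01 x12 x23.
pose F : set (R * X) := [set u |
  u = (0, x0) \/ u = (a, x1) \/ u = (a + b, x2) \/ u = (a + b + c, x3)].
have [|g [gF lg]] := @lipschitz_extension F iX.
  triangle x0 x1 x2; triangle x1 x2 x3; triangle x0 x1 x3.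
  have := mdistxx x0; have := mdistxx x1; have := mdistxx x2; have := mdistxx x3.
  by move=> ? ? ? ? u v [->|[->|[->|->]]] [->|[->|[->|->]]]; rewrite /= ler_normr;
    apply/orP; solve [left; lra|right; lra].
exists g; split=> //; split.
- by apply: (gF (0, x0)); left.
- by apply: (gF (a, x1)); right; left.
- by apply: (gF (a + b, x2)); do 2 right; left.
- by apply: (gF (a + b + c, x3)); do 3 right.
Qed.

Lemma lipschitz_geodesic (g : R -> X) (L : R) : 0 <= L ->
  (forall s t, mdist (g s) (g t) <= `|s - t|) -> mdist (g 0) (g L) = L ->
  geodesic `[0, L] g.
Proof.
move=> L0 lg gL; split; first exact: interval_is_interval.
suff main s t : 0 <= s -> s <= t -> t <= L -> mdist (g s) (g t) = t - s.
  move=> s t; rewrite /= !in_itv/= => /andP[s0 sL] /andP[t0 tL].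
  by case: (lerP s t) => st; [|rewrite mdist_sym]; apply: main => //; exact: ltW.
move=> s0 st tL.
have := lg 0 s; have := lg s t; have := lg t L.
rewrite !ler0_norm; try lra.
triangle (g 0) (g s) (g L); triangle (g s) (g t) (g L); lra.
Qed.

Lemma injective_meet3 x1 x2 x3 (r1 r2 r3 : R) : injective_space X ->
  0 <= r1 -> 0 <= r2 -> 0 <= r3 -> mdist x1 x2 <= r1 + r2 ->
  mdist x1 x3 <= r1 + r3 -> mdist x2 x3 <= r2 + r3 ->
  exists z, [/\ mdist x1 z <= r1, mdist x2 z <= r2 & mdist x3 z <= r3].
Proof.
move=> iX r10 r20 r30 x12 x13 x23.
pose x (i : option bool) := if i is Some b then if b then x1 else x2 else x3.
pose r (i : option bool) := if i is Some b then if b then r1 else r2 else r3.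
have [|i j ij|z zP] := iX _ x r.
- by case=> [[]|].
- by move: i j ij => [[]|] [[]|] //= _; rewrite ?[mdist x2 x1]mdist_sym
    ?[mdist x3 _]mdist_sym // addrC.
by exists z; split; [have := zP (Some true) I|have := zP (Some false) I|have := zP None I].
Qed.

Lemma injective_geodesic : injective_space X -> geodesic_space X.
Proof.
move=> iX x y; have d0 := mdist_ge0 x y.
have [|||g [[g0 gd _ _] lg]] := @lipschitz_path4 x y y y (mdist x y) 0 0 iX;
  rewrite ?mdistxx//.
exists 0, (mdist x y), g; split=> //; apply: lipschitz_geodesic => //.
by rewrite g0 gd.
Qed.

(** If the distance from [x] to [q] were shorter than claimed, the balls around
    [x], [p] and [q] of radii [mdist x p - r], [r] and [mdist p q - r] would meet. A
    common point [z] lies on a geodesic from [p] to [q], but at distance at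
    least [r - 1] from [Y] since it is close to [x]; this contradicts the Morse
    property for [r] beyond the gauge. *)
Lemma morse_gated M Y : injective_space X -> morse_gauge M -> morse M Y ->
  gated (2 * M 1 0 + 4) Y.
Proof.
move=> iX M0 mY x p q xp Yq.
have m0 : 0 <= M 1 0 by apply: M0.
rewrite leNgt; apply/negP => far.
have [r rE] : exists r, r = M 1 0 + 2 by exists (M 1 0 + 2).
have rp : r < mdist p q by triangle x q p; lra.
have rx : r < mdist x p by triangle p x q; lra.
have [||||||z [xz pz qz]] := @injective_meet3 x p q (mdist x p - r) r (mdist p q - r) iX;
  try lra.
have zY y : Y y -> M 1 0 + 1 <= mdist z y.
  by move=> Yy; have := xp.2 _ Yy; triangle x z y; lra.
have [|||f [[f0 fr fL _] lf]] := @lipschitz_path4 p z q q r (mdist p q - r) 0 iX.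
- by [].
- by rewrite mdist_sym.
- by rewrite mdistxx.
have {}fL : f (mdist p q) = q by rewrite -[RHS]fL; congr f; lra.
have L0 := mdist_ge0 p q.
have fgeo : geodesic `[0, mdist p q] f.
  by apply: lipschitz_geodesic => //; rewrite f0 fL.
have [|||y Yy zy] := mY 1 0 (lexx 1) (lexx 0) 0 (mdist p q) f L0
    (geodesic_quasi_geodesic fgeo) _ _ z.
- by rewrite f0; exact: xp.1.
- by rewrite fL.
- by exists r => //; rewrite /= in_itv/=; apply/andP; lra.
have := zY y Yy; lra.
Qed.

Lemma gated_separation C Y x y p q : gated C Y ->
  nearest 1 Y x p -> nearest 1 Y y q ->
  mdist x p - mdist y q + mdist p q <= mdist x y + C.
Proof.
by move=> gY xp yq; have := gY _ _ _ xp yq.1; triangle x y q; lra.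
Qed.

Lemma nearest_shrink Y x p z (t : R) : nearest 1 Y x p ->
  mdist x z <= mdist x p - t -> mdist z p <= t ->
  nearest 1 Y z p /\ mdist z p = t.
Proof.
move=> xp xz zp; have zpE : mdist z p = t by triangle x z p; lra.
split=> //; split; first exact: xp.1.
by move=> q Yq; have := xp.2 _ Yq; triangle x z q; lra.
Qed.

(** Coordinates of [z] relative to [Y]: its height over [Y], and the distance of
    its projection from the base point [p]. *)
Definition coarse_coord C Y p z (u v : R) : Prop :=
  exists r, [/\ nearest 1 Y z r, v - C <= mdist z r <= v + C &
    u - C <= mdist p r <= u + C].

(** The distance in a gated set dominates the l1 distance of the coordinates. *)
Lemma coarse_coord_dist C Y p z z' u v u' v' : gated C Y ->
  coarse_coord C Y p z u v -> coarse_coord C Y p z' u' v' ->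
  u' - u + `|v - v'| <= mdist z z' + 5 * C.
Proof.
move=> gY [r [zr /andP[v1 v2] /andP[u1 u2]]] [r' [zr' /andP[v1' v2'] /andP[u1' u2']]].
have := gated_separation gY zr zr'; have := gated_separation gY zr' zr.
rewrite (mdist_sym r' r) (mdist_sym z' z); triangle p r r'.
by case: (lerP v v') => _; lra.
Qed.

(** A detour from height [s] over [p] to height [s] over [q] that is no longer than
    [mdist p q] has no room to change its height: doing so would cost length
    in addition to the horizontal distance. *)
Lemma coarse_coord_level C Y p q x y z (s t : R) : gated C Y ->
  nearest 1 Y x p -> mdist x p = s -> nearest 1 Y y q -> mdist y q = s ->
  mdist x z <= t -> mdist z y <= mdist p q - t -> coarse_coord C Y p z t s.
Proof.
move=> gY xp xps yq yqs xz zy.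
have [|r zr] := @nearest_ex _ _ Y z; first by exists p; exact: xp.1.
exists r.
have := gated_separation gY xp zr; have := gated_separation gY zr xp.
have := gated_separation gY yq zr; have := gated_separation gY zr yq.
rewrite xps yqs (mdist_sym q r) (mdist_sym r p) (mdist_sym z x) (mdist_sym y z).
triangle p r q => a1 a2 a3 a4.
by split=> //; apply/andP; lra.
Qed.

(** The path goes up from [p] to [x], across to [y] at constant height, and down to
    [q]. Its coordinates trace three sides of a rectangle of height [s] and
    width [2 * s], along which the l1 distance is at least half the length. *)
Lemma rectangle_path C Y p q x y (s : R) : injective_space X -> 0 <= C -> 0 <= s ->
  gated C Y -> nearest 1 Y x p -> mdist x p = s -> nearest 1 Y y q -> mdist y q = s ->
  mdist p q = 2 * s -> mdist x y <= 2 * s ->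
  exists h : R -> X, quasi_geodesic 2 (5 * C) `[0, 4 * s] h /\
    [/\ h 0 = p, h s = x & h (4 * s) = q].
Proof.
move=> iX C0 s0 gY xp xps yq yqs pq xy.
have [|||h [[h0 hs hsL hT] lh]] := @lipschitz_path4 p x y q s (2 * s) s iX;
  rewrite ?yqs// 1?mdist_sym ?xps//.
have e3 : s + 2 * s = 3 * s by lra.
have e4 : s + 2 * s + s = 4 * s by lra.
rewrite e4 in hT; rewrite e3 in hsL.
exists h; split=> //.
have up t : 0 <= t <= s -> coarse_coord C Y p (h t) 0 t.
  move=> /andP[t0 ts].
  have [||htp htt] := @nearest_shrink Y x p (h t) t xp.
  - by rewrite xps -hs; have := lh s t; rewrite ger0_norm; lra.
  - by rewrite -[p in X in X <= _]h0; have := lh t 0; rewrite ger0_norm; lra.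
  by exists p; split=> //; rewrite ?htt ?mdistxx; apply/andP; lra.
have across t : s <= t <= 3 * s -> coarse_coord C Y p (h t) (t - s) s.
  move=> /andP[st ts]; apply: (coarse_coord_level gY xp xps yq yqs).
    by rewrite -hs; have := lh s t; rewrite ler0_norm; lra.
  by rewrite -hsL pq; have := lh t (3 * s); rewrite ler0_norm; lra.
have down t : 3 * s <= t <= 4 * s -> coarse_coord C Y p (h t) (2 * s) (4 * s - t).
  move=> /andP[st ts].
  have [||htq htt] := @nearest_shrink Y y q (h t) (4 * s - t) yq.
  - by rewrite yqs -hsL; have := lh (3 * s) t; rewrite ler0_norm; lra.
  - by rewrite -[q in X in X <= _]hT; have := lh t (4 * s); rewrite ler0_norm; lra.
  by exists q; split=> //; rewrite ?htt ?pq; apply/andP; lra.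
have coord t : 0 <= t <= 4 * s -> exists u v, coarse_coord C Y p (h t) u v /\
    [\/ t <= s /\ (u = 0 /\ v = t), (s <= t /\ t <= 3 * s) /\ (u = t - s /\ v = s) |
      3 * s <= t /\ (u = 2 * s /\ v = 4 * s - t)].
  move=> /andP[t0 ts]; have [t1|t1] := lerP t s.
    by exists 0, t; split; [apply: up; rewrite t0|constructor 1].
  have [t2|t2] := lerP t (3 * s).
    exists (t - s), s; split; first by apply: across; rewrite (ltW t1).
    by constructor 2; rewrite (ltW t1).
  exists (2 * s), (4 * s - t); split; first by apply: down; rewrite (ltW t2).
  by constructor 3; rewrite (ltW t2).
have lower t t' : 0 <= t -> t <= t' -> t' <= 4 * s ->
    2^-1 * (t' - t) - 5 * C <= mdist (h t) (h t').
  move=> t0 tt' ts.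
  have [|u [v [huv uv]]] := coord t; first by rewrite t0 (le_trans tt' ts).
  have [|u' [v' [huv' uv']]] := coord t'; first by rewrite ts (le_trans t0 tt').
  have := coarse_coord_dist gY huv huv'.
  have := ler_norm (v - v'); have := ler_norm (v' - v); rewrite (distrC v' v).
  move: (mdist _ _) `|_| {huv huv' coord up across down lh} => dd n n1 n2.
  move: n1 n2.
  case: uv => [[t1 [-> ->]]|[[t1 t2] [-> ->]]|[t1 [-> ->]]];
    case: uv' => [[t1' [-> ->]]|[[t1' t2'] [-> ->]]|[t1' [-> ->]]]; lra.
split; first exact: interval_is_interval.
move=> t t'; rewrite /= !in_itv/= => /andP[t0 tT] /andP[t0' tT'].
split; last by have := lh t t'; have := normr_ge0 (t - t'); lra.
by case: (lerP t t') => tt'; [|rewrite mdist_sym]; apply: lower => //; exact: ltW.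
Qed.

(** Gatedness alone allows an l1 half-plane over [Y]. There, as here, if [p] and [q] are far
    apart compared to [C], points [x'] over [p] and [y'] over [q] of equal height
    [s := mdist p q / 2] can be found at distance at most [mdist p q]: the
    first is common to balls around [x], [p], [y], where [mdist x y <= mdist x p]
    is used, the second to balls around [q], [y], [x']. The
    quasi-geodesic of [rectangle_path] then has height [s] at [x'], which the
    Morse property bounds. *)
Lemma morse_gated_projection M C Y x y p q : injective_space X -> 0 <= C ->
  morse_gauge M -> morse M Y -> gated C Y ->
  nearest 1 Y x p -> nearest 1 Y y q -> mdist x y <= mdist x p ->
  mdist p q <= 2 * C + 2 * M 2 (5 * C) + 4.
Proof.
move=> iX C0 M0 mY gY xp yq xy; rewrite leNgt; apply/negP => far.
have C5 : 0 <= 5 * C by lra.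
have l2 : 1 <= 2 :> R by lra.
have m0 : 0 <= M 2 (5 * C) by apply: M0.
have [s pqs] : exists s, mdist p q = 2 * s by exists (mdist p q / 2); lra.
have SL : mdist p q - C <= mdist y q by have := gated_separation gY xp yq; lra.
have RL : mdist p q - C <= mdist x p.
  by have := gated_separation gY yq xp; rewrite (mdist_sym q p) (mdist_sym y x); lra.
have yp : mdist y q + mdist p q <= mdist y p + C.
  by have := gY _ _ _ yq xp.1; rewrite (mdist_sym q p).
have [||||||x' [xx' px' yx']] :=
  @injective_meet3 x p y (mdist x p - s) s (mdist y p - s) iX;
  rewrite ?(mdist_sym p y); try lra.
have [||||||y' [qy' yy' xy']] :=
  @injective_meet3 q y x' s (mdist y q - s) (2 * s) iX;
  rewrite ?(mdist_sym q y); try lra.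
- by triangle q p x'; lra.
- by triangle y q p; lra.
have [||x'p x'ps] := @nearest_shrink Y x p x' s xp; [lra|by rewrite mdist_sym|].
have [||y'q y'qs] := @nearest_shrink Y y q y' s yq; [lra|by rewrite mdist_sym|].
have s0 : 0 <= s by lra.
have T0 : 0 <= 4 * s by lra.
have [h [hq [h0 hs hT]]] := rectangle_path iX C0 s0 gY x'p x'ps y'q y'qs pqs xy'.
have [|||w Yw x'w] := mY 2 (5 * C) l2 C5 0 (4 * s) h T0 hq _ _ x'.
- by rewrite h0; exact: xp.1.
- by rewrite hT; exact: yq.1.
- by exists s => //; rewrite /= in_itv/=; apply/andP; lra.
have := x'p.2 _ Yw; lra.
Qed.

Lemma injective_strongly_contracting :
  injective_space X -> morse_geodesics_strongly_contracting X.
Proof.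
move=> iX M M0; have m0 : 0 <= M 1 0 by apply: M0.
have [C CE] : exists C, C = 2 * M 1 0 + 4 by exists (2 * M 1 0 + 4).
have C0 : 0 <= C by lra.
have m1 : 0 <= M 2 (5 * C) by apply: M0; lra.
pose D := 2 * C + 2 * M 2 (5 * C) + 4.
exists (2 * D); first by rewrite /D; lra.
move=> I g _; set Y := g @` I => mY x r r0 rY.
have gY := morse_gated iX M0 mY; rewrite -CE in gY.
apply: ge_ereal_sup => _ [[p q] [[z1 xz1 [/= Yp z1p]] [z2 xz2 [/= Yq z2q]]] <-] /=.
rewrite lee_fin.
have [|x0 xx0] := @nearest_ex _ _ Y x; first by exists p.
have rx0 : r < mdist x x0.
  rewrite ltNge; apply/negP => h; suff : set0 x0 by [].
  by rewrite -rY; split=> //; exact: xx0.1.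
have near z v : Y v -> mdist z v <= dist_to z Y + 1 -> nearest 1 Y z v.
  move=> Yv zv; split=> // w Yw; apply: (le_trans zv); rewrite lerD2r.
  apply: ge_inf; last by exists w.
  by exists 0 => _ [? _ <-]; exact: mdist_ge0.
have proj z v : cball x r z -> nearest 1 Y z v -> mdist x0 v <= D.
  rewrite /cball/= => xz zv.
  by apply: (morse_gated_projection iX C0 M0 mY gY xx0 zv); lra.
have := proj _ _ xz1 (near _ _ Yp z1p); have := proj _ _ xz2 (near _ _ Yq z2q).
triangle p x0 q; lra.
Qed.

End Injective.

Theorem theorem6 (R : realType) :
  (forall X : metricType R,
     geodesic_space X ->
     morse_geodesics_strongly_contracting X ->
     morse_local_to_global X) /\
  (forall X : metricType R,
     injective_space X -> morse_local_to_global X).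
Proof.
split=> X; first exact: contracting_local_to_global.
move=> iX; apply: contracting_local_to_global.
  exact: injective_geodesic.
exact: injective_strongly_contracting.
Qed.
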